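(* For any integer $n\geq 1$, the monoid $M_n$ with generators $a,b$ presented by the (finite) confluent noetherian rewriting system $$a^{n+1}ba^{i}b \to 1\quad (i=n,n-1,\ldots,1),\qquad a^{n+1}b^2\to b$$ is bisimple, $\mathcal{H}$-trivial and congruence-free.
   Context: The monoid presented by a rewriting system over the alphabet $\{a,b\}$ is the quotient of the free monoid $\{a,b\}^*$ by the congruence generated by the pairs (left-hand side, right-hand side) of the rules; $1$ denotes the empty word / identity. Thus $M_n=\langle a,b \mid a^{n+1}ba^{i}b=1\ (1\leq i\leq n),\ a^{n+1}b^2=b\rangle$ as a monoid. Noetherian means there are no infinite chains of rewriting steps; confluent means any two words obtained from the same word by rewriting can be rewritten to a common word. Green's relations on a monoid $M$: $x\mathcal{R}y$ iff $xM=yM$; $x\mathcal{L}y$ iff $Mx=My$; $\mathcal{H}=\mathcal{R}\cap\mathcal{L}$; $\mathcal{D}=\mathcal{R}\circ\mathcal{L}$. A monoid is bisimple if it has a single $\mathcal{D}$-class, and $\mathcal{H}$-trivial if $\mathcal{H}$ is the equality relation. A congruence on a monoid is an equivalence relation compatible with multiplication on both sides. $M_n$ is congruence-free means: for every congruence $\rho$ on $M_n$ and all $u\neq v$ in $M_n$ such that $u\,\rho\,v$, it follows that $\rho=M_n\times M_n$. *)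

(* Defs.v *)
From HB Require Import structures.
From Stdlib Require Import Relation_Operators.
From mathcomp Require Import all_boot.
From mathcomp Require Import boolp classical_sets.

Set Implicit Arguments.
Unset Strict Implicit.
Unset Printing Implicit Defensive.

Local Open Scope quotient_scope.
Local Open Scope classical_set_scope.
Local Open Scope group_scope.

Definition congruence (M : monoidType) (rho : M -> M -> Prop) : Prop :=
  [/\ forall x, rho x x,
      forall x y, rho x y -> rho y x,
      forall x y z, rho x y -> rho y z -> rho x z,
      forall m x y, rho x y -> rho (m * x) (m * y)
    & forall m x y, rho x y -> rho (x * m) (y * m)].

Definition congruence_generated (M : monoidType) (S : seq (M * M)) (x y : M)
    : Prop :=
  forall rho : M -> M -> Prop,
    congruence rho -> (forall p, p \in S -> rho p.1 p.2) -> rho x y.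

Definition congruence_free (M : monoidType) : Prop :=
  forall rho : M -> M -> Prop, congruence rho ->
  forall u v : M, u <> v -> rho u v -> forall x y, rho x y.

Section Green.
Variable M : monoidType.
Implicit Types x y : M.

Definition greenR x y : Prop :=
  [set x * m | m in [set: M]] = [set y * m | m in [set: M]].

Definition greenL x y : Prop :=
  [set m * x | m in [set: M]] = [set m * y | m in [set: M]].

Definition greenH x y : Prop := greenR x y /\ greenL x y.

Definition greenD x y : Prop := exists z, greenR x z /\ greenL z y.

End Green.

Definition bisimple (M : monoidType) : Prop := forall x y : M, greenD x y.

Definition Htrivial (M : monoidType) : Prop :=
  forall x y : M, greenH x y <-> x = y.

(* An alias, so that the monoid structure is not attached to every [seq]. *)
Definition free_monoid (X : choiceType) : Type := seq X.

HB.instance Definition _ (X : choiceType) := Choice.on (free_monoid X).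
HB.instance Definition _ (X : choiceType) :=
  isMonoid.Build (free_monoid X) (@catA X) (@cat0s X) (@cats0 X).

Definition letter (X : choiceType) (x : X) : free_monoid X := [:: x].

Section Rewriting.
Variables (X : choiceType) (S : seq (free_monoid X * free_monoid X)).
Implicit Types u v w : free_monoid X.

Definition rewrite_step u v : Prop :=
  exists x y p, [/\ p \in S, u = x * p.1 * y & v = x * p.2 * y].

Definition rewrites : free_monoid X -> free_monoid X -> Prop :=
  clos_refl_trans _ rewrite_step.

Definition noetherian : Prop :=
  ~ exists u : nat -> free_monoid X, forall k, rewrite_step (u k) (u k.+1).

Definition confluent : Prop :=
  forall w u v, rewrites w u -> rewrites w v ->
  exists z, rewrites u z /\ rewrites v z.

End Rewriting.

Section GeneratedCongruence.
Variables (M : monoidType) (S : seq (M * M)).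

Lemma congruence_generated_congruence : congruence (congruence_generated S).
Proof.
split=> [x|x y xy|x y z xy yz|m x y xy|m x y xy] rho rhoC rhoS;
  case: (rhoC) => rR rS rT rMl rMr.
- exact: rR.
- by apply: rS; apply: xy.
- by apply: (rT _ y); [apply: xy | apply: yz].
- by apply: rMl; apply: xy.
- by apply: rMr; apply: xy.
Qed.

Definition congruence_generated_rel : rel M :=
  fun x y => `[< congruence_generated S x y >].

Lemma congruence_generated_rel_equiv :
  equiv_class_of congruence_generated_rel.
Proof.
have [rR rS rT _ _] := congruence_generated_congruence.
apply: EquivClass => [x|x y|y x z]; first by apply/asboolP; apply: rR.
- by rewrite /congruence_generated_rel; congr asbool; apply/propext; split;
    apply: rS.
- by move=> /asboolP xy /asboolP yz; apply/asboolP; apply: rT xy yz.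
Qed.

Canonical congruence_generated_equiv :=
  EquivRelPack congruence_generated_rel_equiv.

End GeneratedCongruence.

Definition presented_monoid (X : choiceType)
    (S : seq (free_monoid X * free_monoid X)) : Type :=
  {eq_quot (congruence_generated_equiv S)}.

Section PresentedMonoid.
Variables (X : choiceType) (S : seq (free_monoid X * free_monoid X)).
Local Notation Q := (presented_monoid S).

HB.instance Definition _ := Choice.on Q.
HB.instance Definition _ := EqQuotient.on Q.

Lemma presented_piP (u v : free_monoid X) :
  \pi_Q u = \pi_Q v <-> congruence_generated S u v.
Proof.
by split=> [/eqmodP/asboolP|uv]; last apply/eqmodP/asboolP.
Qed.

Definition presented_mul (x y : Q) : Q := \pi_Q (repr x * repr y).

Lemma presented_pi_mul (u v : free_monoid X) :
  presented_mul (\pi_Q u) (\pi_Q v) = \pi_Q (u * v).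
Proof.
apply/presented_piP.
have [_ _ rT rMl rMr] := congruence_generated_congruence S.
by apply: (rT _ (u * repr (\pi_Q v))); [apply: rMr | apply: rMl];
  apply/presented_piP; rewrite reprK.
Qed.

Lemma presented_mulA : associative presented_mul.
Proof.
move=> x y z; rewrite -[x]reprK -[y]reprK -[z]reprK.
move: (repr x) (repr y) (repr z) => u v w.
rewrite (presented_pi_mul v w) (presented_pi_mul u v) !presented_pi_mul.
by rewrite mulgA.
Qed.

Lemma presented_mul1 : left_id (\pi_Q 1) presented_mul.
Proof. by move=> x; rewrite -[x]reprK presented_pi_mul mul1g. Qed.

Lemma presented_mulr1 : right_id (\pi_Q 1) presented_mul.
Proof. by move=> x; rewrite -[x]reprK presented_pi_mul mulg1. Qed.

HB.instance Definition _ :=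
  isMonoid.Build Q presented_mulA presented_mul1 presented_mulr1.

End PresentedMonoid.

Lemma presented_piM (X : choiceType)
    (S : seq (free_monoid X * free_monoid X)) (u v : free_monoid X) :
  let Q : monoidType := presented_monoid S in
  (\pi_(presented_monoid S) (u * v) : Q)
    = \pi_(presented_monoid S) u * \pi_(presented_monoid S) v.
Proof. by move=> Q; rewrite -presented_pi_mul. Qed.

(* The alphabet {a, b} is encoded by [bool]; [1] is the empty word. *)
Definition a : free_monoid bool := letter false.
Definition b : free_monoid bool := letter true.

Definition M_rules (n : nat) : seq (free_monoid bool * free_monoid bool) :=
  [seq (a ^+ n.+1 * b * a ^+ i * b, 1) | i <- rev (iota 1 n)]
    ++ [:: (a ^+ n.+1 * b ^+ 2, b)].

Definition M_monoid (n : nat) : monoidType := presented_monoid (M_rules n).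

(* Main.v *)
(** Write N = n+1 and alpha = a^N b.  The irreducible words are l r with l a
    product of blocks a^k b (k <= n) and r a word in a and alpha.  Letting a and b
    act on these normal forms from the right gives an action of M_n, so they are
    pairwise distinct in M_n.

    Every l is left invertible and every r is right invertible, so l r' is
    R-related to l r and L-related to l' r': M_n is bisimple.  Multiplication on
    the right only extends l, and multiplying r on the left only puts letters in
    front of it, so R and L determine l and r and M_n is H-trivial.

    For a nontrivial congruence, multiply a pair of distinct related normal forms
    by one-sided inverses of their outer factors.  By induction on total length
    this reaches a pair making a left invertible or some a^k b (k <= n) right
    invertible modulo the congruence; either forces a ~ b ~ 1. *)
Require Import Defs.
From Stdlib Require Import Relation_Operators.
From mathcomp Require Import all_boot.
From mathcomp Require Import boolp classical_sets.
From mathcomp Require Import zify.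

Set Implicit Arguments.
Unset Strict Implicit.
Unset Printing Implicit Defensive.

Local Open Scope quotient_scope.
Local Open Scope group_scope.

(** * Green's relations in an arbitrary monoid *)

Lemma greenR_sym (M : monoidType) (x y : M) : greenR x y -> greenR y x.
Proof. by rewrite /greenR => ->. Qed.

Lemma greenR_mul (M : monoidType) (x y : M) : greenR x y -> exists m, y = x * m.
Proof.
move=> xy; have : [set y * m | m in [set: M]]%classic y by exists 1; rewrite ?mulg1.
by rewrite -xy => -[m _ <-]; exists m.
Qed.

Lemma greenL_sym (M : monoidType) (x y : M) : greenL x y -> greenL y x.
Proof. by rewrite /greenL => ->. Qed.

Lemma greenL_mul (M : monoidType) (x y : M) : greenL x y -> exists m, y = m * x.
Proof.
move=> xy; have : [set m * y | m in [set: M]]%classic y by exists 1; rewrite ?mul1g.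
by rewrite -xy => -[m _ <-]; exists m.
Qed.

Lemma greenR_rinv (M : monoidType) (x r : M) :
  (exists q, r * q = 1) -> greenR x (x * r).
Proof.
case=> q rq; apply/seteqP; split=> _ [m _ <-].
  by exists (q * m) => //; rewrite -mulgA (mulgA r) rq mul1g.
by exists (r * m) => //; rewrite mulgA.
Qed.

Lemma greenL_linv (M : monoidType) (l r : M) :
  (exists p, p * l = 1) -> greenL r (l * r).
Proof.
case=> p pl; apply/seteqP; split=> _ [m _ <-].
  by exists (m * p) => //; rewrite -mulgA (mulgA p) pl mul1g.
by exists (m * l) => //; rewrite mulgA.
Qed.

Lemma prefix_anti (T : eqType) (s t : seq T) : prefix s t -> prefix t s -> s = t.
Proof.
move=> /prefixP[u ->] /size_prefix; rewrite size_cat.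
by case: u => [|x u]; rewrite ?cats0 //=; lia.
Qed.

(** * Normal forms *)

Section Words.
Variable n : nat.
Local Notation N := n.+1.
Local Notation rules := (M_rules n).
Local Notation word := (free_monoid bool).

(* [State L J m] encodes the normal form [l r]: [L] lists the exponents of the
   blocks of [l] from left to right; [r] ends in [a^m], and [J] lists, from right
   to left, the [j] of its blocks [a^(N + j) b]. *)
Record state := State { low : seq nat; high : seq nat; tail : nat }.

Fixpoint low_word (L : seq nat) : seq bool :=
  if L is k :: L' then nseq k false ++ true :: low_word L' else [::].

Fixpoint high_word (J : seq nat) (m : nat) : seq bool :=
  if J is j :: J' then high_word J' (N + j) ++ true :: nseq m false
  else nseq m false.

Definition state_word s : word := low_word (low s) ++ high_word (high s) (tail s).

(** The branches for [m <= n] mirror the rules. With a block of [r] before [a^m b], [m > 0] is the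
    rule [a^N b a^m b -> 1], while for [m = 0] the rule [a^N b b -> b] leaves a [b] that still has
    to be absorbed, hence the recursion. *)
Fixpoint push_b L J m : state :=
  if m <= n then
    if J is j :: J' then if m == 0 then push_b L J' j else State L J' j
    else State (rcons L m) [::] 0
  else State L (m - N :: J) 0.

Definition push s (c : bool) : state :=
  if c then push_b (low s) (high s) (tail s) else State (low s) (high s) (tail s).+1.

Definition run s (w : word) : state := foldl push s w.

Definition valid s := all (fun k => k <= n) (low s).

Lemma run_cat s u v : run s (u ++ v) = run (run s u) v.
Proof. exact: foldl_cat. Qed.

Lemma run_as L J m k : run (State L J m) (nseq k false) = State L J (m + k).
Proof.
elim: k m => [|k IH] m; first by rewrite addn0.
by rewrite /= [LHS]IH addSnnS.
Qed.

Lemma push_b_high L J m : push_b L J (N + m) = State L (m :: J) 0.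
Proof.
by case: J => [|j J] /=; rewrite ifN ?addKn // -ltnNge; lia.
Qed.

Lemma push_b_pop L j J m :
  0 < m <= n -> push_b L (j :: J) m = State L J j.
Proof. by move=> /andP[m0 /= ->]; rewrite ifN // -lt0n. Qed.

Lemma expg_a k : a ^+ k = nseq k false.
Proof. by elim: k => [|k IH] //; rewrite expgS IH. Qed.

Lemma rule_word i :
  a ^+ N * b * a ^+ i * b = nseq N false ++ true :: nseq i false ++ [:: true].
Proof. by rewrite !expg_a -!mulgA. Qed.

Lemma rule0_word : a ^+ N * b ^+ 2 = nseq N false ++ [:: true; true].
Proof. by rewrite expg_a. Qed.

Lemma mem_rules p : p \in rules ->
  (exists2 i, 0 < i <= n & p = (nseq N false ++ true :: nseq i false ++ [:: true], [::]))
  \/ p = (nseq N false ++ [:: true; true], [:: true]).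
Proof.
rewrite mem_cat => /orP[/mapP[i]|].
  rewrite mem_rev mem_iota add1n ltnS => hi ->; left; exists i => //.
  by rewrite rule_word.
by rewrite inE => /eqP ->; right; rewrite rule0_word.
Qed.

Lemma rule_in i : 0 < i <= n ->
  (nseq N false ++ true :: nseq i false ++ [:: true], [::]) \in rules.
Proof.
move=> hi; rewrite mem_cat; apply/orP; left; apply/mapP; exists i.
  by rewrite mem_rev mem_iota add1n ltnS.
by rewrite rule_word.
Qed.

Lemma rule0_in : (nseq N false ++ [:: true; true], [:: true]) \in rules.
Proof. by rewrite mem_cat !inE rule0_word eqxx orbT. Qed.

(** After [a^N] the tail is [N + m], so [b] stores exactly [m] in a new block. The rest of the rule
    pops that block and restores the tail [m], followed by a push of [b] for the last rule. *)
Lemma run_rule p s : p \in rules -> run s p.1 = run s p.2.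
Proof.
case: s => L J m /mem_rules[[i hi ->]|->];
  rewrite run_cat run_as addnC [LHS]/= /push push_b_high.
  rewrite [LHS](run_cat _ (nseq i false)) run_as add0n [LHS]/= /push.
  exact: push_b_pop.
by [].
Qed.

Lemma run_congruence u v s :
  congruence_generated rules u v -> run s u = run s v.
Proof.
move=> uv; apply: (uv (fun u v => forall s, run s u = run s v)).
- split=> [//|x y xy t|x y z xy yz t|w x y xy t|w x y xy t].
  + by rewrite xy.
  + by rewrite xy.
  + by rewrite !run_cat.
  + by rewrite !run_cat xy.
- by move=> p pS t; apply: run_rule.
Qed.

(** * Reduction to normal form by rewriting *)

Lemma rewrites_cong u v : rewrites rules u v -> congruence_generated rules u v.
Proof.
have [rR rS rT rMl rMr] := congruence_generated_congruence rules.
elim=> [{}u {}v [x [y [p [pS -> ->]]]]|{}u|{}u {}v w _ uv _ vw].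
- apply: rMr; apply: rMl => rho _ hS; exact: hS.
- exact: rR.
- exact: rT vw.
Qed.

Lemma rewritesM x y u v : rewrites rules u v -> rewrites rules (x * u * y) (x * v * y).
Proof.
elim=> [{}u {}v [x' [y' [p [pS -> ->]]]]|{}u|{}u {}v w _ uv _ vw].
- apply: rt_step; exists (x * x'), (y' * y), p; split=> //; by rewrite !mulgA.
- exact: rt_refl.
- exact: rt_trans vw.
Qed.

Lemma rewrites_rule x y p :
  p \in rules -> rewrites rules (x ++ p.1 ++ y) (x ++ p.2 ++ y).
Proof.
move=> pS; apply: rt_step; exists x, y, p; split=> //; exact: catA.
Qed.

Lemma high_word_tail J m k : high_word J (m + k) = high_word J m ++ nseq k false.
Proof. by case: J => [|j J] /=; rewrite nseqD // -catA. Qed.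

Lemma low_word_rcons L k :
  low_word (rcons L k) = low_word L ++ nseq k false ++ [:: true].
Proof. by elim: L => [|l L IH] //=; rewrite IH -catA. Qed.

Lemma state_word_high L J m : n < m ->
  state_word (State L (m - N :: J) 0) = state_word (State L J m) ++ [:: true].
Proof. by move=> nm; rewrite -{2}(subnKC nm) /state_word -catA. Qed.

(** Each recursive call of [push_b] is one use of [a^N b b -> b], so the induction follows the
    blocks of [r] from the right. *)
Lemma rewrites_push_b L J m :
  rewrites rules (state_word (State L J m) ++ [:: true]) (state_word (push_b L J m)).
Proof.
elim: J m => [|j J IH] m; rewrite /push_b -/push_b; case: (leqP m n) => hm.
- rewrite /state_word /= low_word_rcons -catA cats0; exact: rt_refl.
- rewrite state_word_high //; exact: rt_refl.
- have eqw : state_word (State L (j :: J) m) ++ [:: true] =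
      state_word (State L J j)
      ++ (nseq N false ++ true :: nseq m false ++ [:: true]).
    by rewrite /state_word /= addnC high_word_tail -!catA.
  rewrite eqw {eqw}; case: m hm => [|m] hm.
    apply: rt_trans (IH j).
    by have := rewrites_rule (state_word (State L J j)) [::] rule0_in; rewrite !cats0.
  by have := rewrites_rule (state_word (State L J j)) [::] (@rule_in m.+1 hm);
    rewrite !cats0.
- rewrite state_word_high //; exact: rt_refl.
Qed.

Lemma rewrites_run s w : rewrites rules (state_word s ++ w) (state_word (run s w)).
Proof.
elim: w s => [|c w IH] s /=; first by rewrite cats0; exact: rt_refl.
apply: rt_trans (IH (push s c)).
rewrite -cat1s catA.
suff h : rewrites rules (state_word s ++ [:: c]) (state_word (push s c)).
  by have := rewritesM 1 w h; rewrite !mul1g.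
case: c; case: s => L J m; first exact: rewrites_push_b.
by rewrite /push /state_word /= -addn1 high_word_tail -catA; exact: rt_refl.
Qed.

Lemma valid_push_b L J m : valid (State L J m) -> valid (push_b L J m).
Proof.
elim: J m => [|j J IH] m vL /=; case: leqP => hm //.
  by rewrite /valid /= all_rcons hm.
by case: eqP => // _; apply: IH.
Qed.

Lemma valid_run s w : valid s -> valid (run s w).
Proof.
elim: w s => [|c w IH] s vs //=; apply: IH.
by case: c; case: s vs => L J m; first exact: valid_push_b.
Qed.

Lemma run_low L0 L : all (fun k => k <= n) L ->
  run (State L0 [::] 0) (low_word L) = State (L0 ++ L) [::] 0.
Proof.
elim: L L0 => [|k L IH] L0 /=; first by rewrite cats0.
case/andP=> hk hL; rewrite run_cat run_as add0n /= hk.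
by rewrite [LHS]IH // cat_rcons.
Qed.

Lemma run_high L J m : run (State L [::] 0) (high_word J m) = State L J m.
Proof.
elim: J m => [|j J IH] m /=; first exact: run_as.
by rewrite run_cat IH [LHS]/= /push push_b_high [LHS]run_as.
Qed.

Definition empty_state := State [::] [::] 0.

Lemma run_state_word s : valid s -> run empty_state (state_word s) = s.
Proof.
by case: s => L J m vs; rewrite /state_word run_cat run_low // run_high.
Qed.

(* Prepending to a high word never creates a redex: the first block only grows. *)
Lemma run_high_cat L0 J0 m0 J m :
  exists J1 m1, [/\ run (State L0 J0 m0) (high_word J m) = State L0 J1 m1, m <= m1
    & high_word J1 m1 = high_word J0 m0 ++ high_word J m].
Proof.
elim: J m => [|j J IH] m /=.
  by exists J0, (m0 + m); rewrite run_as leq_addl high_word_tail.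
have [J1 [m1 [eq1 le1 eqw]]] := IH (N + j).
exists (m1 - N :: J1), m; split=> //.
- rewrite run_cat eq1 [LHS]/= /push /=.
  have -> : m1 = N + (m1 - N) by lia.
  by rewrite push_b_high [LHS]run_as addKn.
- by rewrite /= subnKC ?eqw ?catA //; lia.
Qed.

Lemma low_push_b L J m : prefix L (low (push_b L J m)).
Proof.
elim: J m => [|j J IH] m /=; case: leqP => hm; rewrite ?prefix_refl //.
  by rewrite /= -cats1 prefix_prefix.
by case: eqP => // _; rewrite prefix_refl.
Qed.

Lemma low_run s w : prefix (low s) (low (run s w)).
Proof.
elim: w s => [|c w IH] s /=; first exact: prefix_refl.
apply: prefix_trans (IH (push s c)).
by case: c; [exact: low_push_b|exact: prefix_refl].
Qed.

(** Needed for the induction on total length: passing to the normal form of a product must not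
    lengthen the word. *)
Lemma size_push_b L J m :
  size (state_word (push_b L J m)) <= (size (state_word (State L J m))).+1.
Proof.
elim: J m => [|j J IH] m; rewrite /push_b -/push_b; case: (leqP m n) => hm.
- by rewrite /state_word /= low_word_rcons !size_cat /= size_nseq; lia.
- by rewrite state_word_high // size_cat addn1.
- have le : size (state_word (State L J j)) < size (state_word (State L (j :: J) m)).
    by rewrite /state_word /= addnC high_word_tail !size_cat /= !size_nseq; lia.
  by case: eqP => _; [have := IH j|]; lia.
- by rewrite state_word_high // size_cat addn1.
Qed.

Lemma size_run s w : size (state_word (run s w)) <= size (state_word s) + size w.
Proof.
elim: w s => [|c w IH] s /=; first by rewrite addn0.
apply: leq_trans (IH (push s c)) _; rewrite addnS -addSn leq_add2r.
case: c; case: s => L J m; first exact: size_push_b.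
by rewrite /push /state_word /= -addn1 high_word_tail !size_cat size_nseq; lia.
Qed.

(** * Termination and confluence *)

Lemma noetherian_rules : noetherian rules.
Proof.
have dec u v : rewrite_step rules u v -> size v < size u.
  case=> x [y [p [/mem_rules[[i hi ->]|->] -> ->]]]; rewrite !size_cat /=.
    by rewrite !size_cat /= !size_nseq; lia.
  by rewrite !size_nseq; lia.
case=> u hu; have bd k : size (u k) + k <= size (u 0).
  by elim: k => [|k IH]; [lia|have := dec _ _ (hu k); lia].
by have := bd (size (u 0)).+1; lia.
Qed.

(** All descendants of [w] run to the same state, and its word is their common reduct. *)
Lemma confluent_rules : confluent rules.
Proof.
move=> w u v wu wv; exists (state_word (run empty_state w)).
have nf x : rewrites rules w x -> rewrites rules x (state_word (run empty_state w)).
  move=> wx; rewrite (run_congruence empty_state (rewrites_cong wx)).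
  exact: (rewrites_run empty_state x).
by split; apply: nf.
Qed.


(** * Green's relations *)

Local Notation Q := (M_monoid n).

Definition eval (w : word) : Q := \pi_(presented_monoid rules) w.

Lemma evalM (u v : seq bool) : eval (u ++ v) = eval u * eval v.
Proof. exact: (presented_piM rules u v). Qed.

Lemma eval_run s w : eval (state_word s) * eval w = eval (state_word (run s w)).
Proof.
rewrite -evalM; apply/presented_piP; apply: rewrites_cong.
exact: rewrites_run.
Qed.

Lemma eval_state (x : Q) : exists2 s, valid s & x = eval (state_word s).
Proof.
exists (run empty_state (repr x)); first exact: valid_run.
rewrite -eval_run /state_word /= [eval [::]](_ : _ = 1) // mul1g.
by rewrite /eval reprK.
Qed.

Lemma eval_inj s t : valid s -> valid t ->
  eval (state_word s) = eval (state_word t) -> s = t.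
Proof.
move=> vs vt /presented_piP /(run_congruence empty_state).
by rewrite !run_state_word.
Qed.

(** * Identities and one-sided inverses in [M_n] *)

Local Notation A := (eval a).
Local Notation B := (eval b).

Lemma eval_as k : eval (nseq k false) = A ^+ k.
Proof. by elim: k => [|k IH] //; rewrite expgS -IH -evalM. Qed.

Lemma eval_block k (w : seq bool) :
  eval (nseq k false ++ true :: w) = A ^+ k * (B * eval w).
Proof. by rewrite evalM eval_as -(evalM [:: true]). Qed.

(* Not the literal product, which rewriting with [mulgA] would unfold. *)
Definition alpha : Q := eval (nseq N false ++ [:: true]).

Lemma alphaE : alpha = A ^+ N * B.
Proof. by rewrite /alpha evalM eval_as. Qed.

Lemma alpha_block k y : 0 < k <= n -> alpha * (A ^+ k * (B * y)) = y.
Proof.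
move=> hk; suff h : A ^+ N * (B * (A ^+ k * B)) = 1.
  by rewrite alphaE -[RHS]mul1g -h !mulgA.
have -> : A ^+ k * B = eval (nseq k false ++ [:: true]) by rewrite evalM eval_as.
rewrite -eval_block; apply/presented_piP => rho _ h.
exact: (h _ (rule_in hk)).
Qed.

Lemma alpha_b y : alpha * (B * y) = B * y.
Proof.
suff h : A ^+ N * (B * B) = B by rewrite -[in RHS]h alphaE !mulgA.
rewrite -[in LHS](eval_block N [:: true]); apply/presented_piP => rho _ h.
exact: (h _ rule0_in).
Qed.

Hypothesis n_gt0 : 0 < n.

Lemma beta_b y : alpha * (A * (B * y)) = y.
Proof. by rewrite -[A]expg1; apply: alpha_block. Qed.

(** No rule erases [a^N b b], so [k = 0] is separate: [alpha a b = 1] makes [alpha a] a left inverse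
    of [b]. *)
Lemma linv_block k : k <= n -> exists p, forall y, p * (A ^+ k * (B * y)) = y.
Proof.
case: k => [|k] hk.
  by exists (alpha * A) => y; rewrite -mulgA mul1g beta_b.
by exists alpha => y; rewrite alpha_block.
Qed.

Lemma rinv_a : exists q, A * q = 1.
Proof.
exists (A ^+ n * B * (A * B)).
by have := @beta_b 1; rewrite alphaE expgS mulg1 !mulgA.
Qed.

Lemma rinv_alpha : alpha * (A * B) = 1.
Proof. by have := @beta_b 1; rewrite mulg1. Qed.

Lemma alpha_anb : alpha * (A ^+ n * B) = 1.
Proof. by have := @alpha_block n 1; rewrite mulg1 => -> //; lia. Qed.

Lemma rinvM (x y : Q) :
  (exists q, x * q = 1) -> (exists q, y * q = 1) -> exists q, x * y * q = 1.
Proof.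
move=> [q xq] [r yr]; exists (r * q).
by rewrite mulgA -(mulgA x) yr mulg1.
Qed.

Lemma rinv_as k : exists q, A ^+ k * q = 1.
Proof.
elim: k => [|k IH]; first by exists 1; rewrite mulg1.
by rewrite expgS; apply: rinvM IH; apply: rinv_a.
Qed.

(** Splitting the last block as [a^j alpha] exhibits [r] as a word in [a] and [alpha], both right
    invertible. *)
Lemma eval_high j J m :
  eval (high_word (j :: J) m) = eval (high_word J j) * (alpha * A ^+ m).
Proof.
rewrite [high_word _ _]/= addnC high_word_tail -catA evalM eval_block eval_as.
by rewrite alphaE !mulgA.
Qed.

Lemma rinv_high J m : exists q, eval (high_word J m) * q = 1.
Proof.
elim: J m => [|j J IH] m /=; first by rewrite eval_as; exact: rinv_as.
rewrite -/(high_word (j :: J) m) eval_high.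
apply: rinvM (IH j) _; apply: rinvM (rinv_as m).
by exists (A * B); apply: rinv_alpha.
Qed.

Lemma linv_low L : all (fun k => k <= n) L ->
  exists p, forall y, p * (eval (low_word L) * y) = y.
Proof.
elim: L => [|k L IH] /=.
  by exists 1 => y; rewrite mul1g [eval _](_ : _ = 1) // mul1g.
case/andP=> /linv_block[p hp] /IH[q hq]; exists (q * p) => y.
by rewrite eval_block -!mulgA hp hq.
Qed.

Lemma greenR_low s t : valid s -> valid t ->
  greenR (eval (state_word s)) (eval (state_word t)) -> prefix (low s) (low t).
Proof.
move=> vs vt /greenR_mul[m]; have [w _ ->] := eval_state m.
rewrite eval_run => /eval_inj -> //; first exact: low_run.
exact: valid_run.
Qed.

Lemma greenL_high L J m J' m' : valid (State L J m) -> valid (State L J' m') ->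
  greenL (eval (state_word (State L J m))) (eval (state_word (State L J' m'))) ->
  exists u, high_word J' m' = u ++ high_word J m.
Proof.
move=> vs vt /greenL_mul[x]; have [p hp] := linv_low vs.
rewrite /state_word /= !evalM => /(congr1 (fun z => p * z)) /=.
(* Cancelling [l] on the left leaves [r'] as a left multiple of [r]. By uniqueness of normal forms
   the low part [L0] of the multiplier is then empty. *)
rewrite hp !mulgA; have [[L0 J0 m0] vw ->] := eval_state (p * x * eval (low_word L)).
rewrite eval_run; have [J1 [m1 [-> _ eqw]]] := run_high_cat L0 J0 m0 J m.
rewrite -[high_word J' m']/(state_word (State [::] J' m')).
move=> /(@eval_inj (State [::] J' m') (State L0 J1 m1) isT vw)[_ -> ->].
by exists (high_word J0 m0).
Qed.

Lemma Htrivial_M : Htrivial Q.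
Proof.
move=> x y; split=> [[xRy xLy]|->] //.
have [[L J m] vs ex] := eval_state x; have [[L' J' m'] vt ey] := eval_state y.
move: xRy xLy; rewrite {x}ex {y}ey => xRy xLy.
have eL : L = L'.
  by apply: prefix_anti; [exact: greenR_low xRy|exact: greenR_low (greenR_sym xRy)].
subst L'; have [u eu] := greenL_high vs vt xLy.
have [u' eu'] := greenL_high vt vs (greenL_sym xLy).
rewrite /state_word /=; congr (eval (_ ++ _)).
(* Each of the two high words is a suffix of the other, so by length [u] is empty. *)
have := congr1 size eu'; rewrite eu !size_cat.
by case: u eu => [//|c u] _ /=; lia.
Qed.

Lemma bisimple_M : bisimple Q.
Proof.
have D1 (x : Q) : exists l r, [/\ x = l * r, exists p, p * l = 1 & exists q, r * q = 1].
  have [[L J m] vs ->] := eval_state x.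
  exists (eval (low_word L)), (eval (high_word J m)); split.
  - by rewrite -evalM.
  - by have [p hp] := linv_low vs; exists p; rewrite -[RHS](hp 1) mulg1.
  - exact: rinv_high.
move=> x y; have [l [r [-> lP rP]]] := D1 x; have [l' [r' [-> lP' rP']]] := D1 y.
exists (l * r'); split.
  rewrite /greenR -(greenR_rinv l rP); exact: (greenR_rinv l rP').
rewrite /greenL -(greenL_linv r' lP); exact: (greenL_linv r' lP').
Qed.

(** * Congruences *)

Lemma size_high_push_b L J m : size (high (push_b L J m)) <= (size J).+1.
Proof.
elim: J m => [|j J IH] m /=; case: (leqP m n) => _ //.
by case: eqP => _ /=; rewrite ?leqnSn ?(leq_trans (IH j)) //; lia.
Qed.

(** Either the number of blocks in [l] or [r] changes, or an exponent drops by [N]. *)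
Lemma push_b_neq L J m : push_b L J m <> State L J m.
Proof.
case: J => [|j J] /=; case: (leqP m n) => hm.
- by move/(congr1 (fun s => size (low s))) => /=; rewrite size_rcons; lia.
- by case.
- case: eqP => m0; last by move/(congr1 (fun s => size (high s))) => /=; lia.
  case: J => [|i J] /=; case: (leqP j n) => hj.
  + by case.
  + by case; lia.
  + case: eqP => _; move/(congr1 (fun s => size (high s))) => /=; last by lia.
    by have := size_high_push_b L J i; lia.
  + by case; lia.
- by move/(congr1 (fun s => size (high s))) => /=; lia.
Qed.

(** With [r] given by [J] and [m], this separates [r a a b] from [r alpha]. A new block would store
    [m + 2 - N], which equals [m] only for [n = 1]. *)
Lemma push_b2_neq J m : 1 < n -> push_b [::] J m.+2 <> State [::] (m :: J) 0.
Proof.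
move=> n1; case: J => [|j J] /=; case: (leqP m.+2 n) => hm //.
- by case; lia.
- by move/(congr1 (fun s => size (high s))) => /=; lia.
- by case; lia.
Qed.

Lemma push_b1_neq J m : n = 1%N -> push_b [::] J m.+1 <> push_b [::] J m.
Proof.
move=> n1; have H := @push_b_neq [::].
case: J => [|j J]; case: m => [|[|m]] /=; rewrite n1 //=.
- by case; lia.
(* Here [m = 0]: [a b] cancels the last block down to [a^j], while [b] leaves [a^j b]. *)
- exact: nesym.
- by move/(congr1 (fun s => size (high s))) => /=; lia.
- by case; lia.
Qed.

Section Congruence.
Variable rho : Q -> Q -> Prop.
Hypothesis rho_cong : congruence rho.

Let rhoxx x : rho x x. Proof. by case: rho_cong. Qed.
Let rho_sym x y : rho x y -> rho y x. Proof. by case: rho_cong => _ h _ _ _; apply: h. Qed.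
Let rho_trans y x z : rho x y -> rho y z -> rho x z.
Proof. by case: rho_cong => _ _ h _ _; apply: h. Qed.
Let rhoMl z x y : rho x y -> rho (z * x) (z * y).
Proof. by case: rho_cong => _ _ _ h _; apply: h. Qed.
Let rhoMr z x y : rho x y -> rho (x * z) (y * z).
Proof. by case: rho_cong => _ _ _ _ h; apply: h. Qed.

Let full := forall x y, rho x y.
Let linv x := exists p, rho (p * x) 1.
Let rinv x := exists q, rho (x * q) 1.

Lemma cong_cancel_l x y z : linv x -> rho (x * y) (x * z) -> rho y z.
Proof.
case=> p px /(rhoMl p); rewrite !mulgA => h.
apply: rho_trans (rho_trans h _); last by rewrite -[z in X in rho _ X]mul1g; apply: rhoMr.
by rewrite -{1}[y]mul1g; apply/rhoMr/rho_sym.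
Qed.

Lemma cong_cancel_r x y z : rinv x -> rho (y * x) (z * x) -> rho y z.
Proof.
case=> q xq /(rhoMr q); rewrite -!mulgA => h.
apply: rho_trans (rho_trans h _); last by rewrite -[z in X in rho _ X]mulg1; apply: rhoMl.
by rewrite -{1}[y]mulg1; apply/rhoMl/rho_sym.
Qed.

Lemma rinv_rho x : (exists q, x * q = 1) -> rinv x.
Proof. by case=> q xq; exists q; rewrite xq. Qed.

Lemma full_of_letters : rho A 1 -> rho B 1 -> full.
Proof.
move=> A1 B1; suff h x : rho x 1 by move=> x y; apply: rho_trans (rho_sym (h y)).
rewrite -[x]reprK; elim: (repr x) => [|c w IH]; first exact: rhoxx.
rewrite -/(eval _) -cat1s evalM.
apply: rho_trans IH; rewrite -[X in rho _ X]mul1g.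
by apply: rhoMr; case: c.
Qed.

Lemma rho_alpha_1 : rinv B -> rho alpha 1.
Proof.
move=> Br; apply: (cong_cancel_r Br).
by have := alpha_b 1; rewrite !mulg1 mul1g => ->.
Qed.

Lemma linv_as k : linv A -> linv (A ^+ k).
Proof.
case=> p pA; elim: k => [|k [q qA]]; first by exists 1; rewrite mulg1.
exists (q * p); rewrite expgS -mulgA; apply: rho_trans qA; apply: rhoMl.
by rewrite mulgA -[X in rho _ X]mul1g; apply: rhoMr.
Qed.

(** Being right invertible already, [a] becomes a unit. Then [a^N b a^n b = 1] makes [b] right
    invertible, so [alpha ~ 1] and hence [a^n b ~ 1]. Comparing with [alpha = a^n a b] gives
    [a ~ 1], and finally [b ~ alpha ~ 1]. *)
Lemma full_linv_a : linv A -> full.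
Proof.
move=> Al; have ANl := linv_as N Al; have [I AI] := rinv_as N.
have IA : rho (I * A ^+ N) 1.
  by apply: (cong_cancel_l ANl); rewrite mulgA AI mul1g mulg1.
have Br : rinv B.
  exists (A ^+ n * B * A ^+ N); apply: rho_trans IA; rewrite mulgA; apply: rhoMr.
  by apply: (cong_cancel_l ANl); rewrite AI mulgA -alphaE alpha_anb.
have alpha1 := rho_alpha_1 Br.
have AnB : rho (A ^+ n * B) 1.
  by rewrite -[X in rho _ X]alpha_anb -{1}[_ * B]mul1g; apply/rhoMr/rho_sym.
have A1 : rho A 1.
  apply: (cong_cancel_l (linv_as n Al)); apply: (cong_cancel_r Br).
  by rewrite -expgSr -alphaE mulg1; apply: rho_trans alpha1 (rho_sym AnB).
apply: (full_of_letters A1); apply: rho_trans alpha1.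
rewrite alphaE -{1}[B]mul1g; apply: rhoMr; apply: rho_sym.
elim: N => [|k IH] //; rewrite expgS; apply: rho_trans A1.
by rewrite -[X in rho _ X]mulg1; apply: rhoMl.
Qed.

Lemma linv_expg_a k : linv (A ^+ k.+1) -> linv A.
Proof. by case=> p; rewrite expgSr mulgA; exists (p * A ^+ k). Qed.

(** It suffices to make a positive power of [a] left invertible. If [b] is right invertible, then
    [alpha ~ 1] and [a b ~ 1], so [a^n ~ alpha ~ 1]. For [k > 0], [alpha] becomes a two-sided
    inverse of [C = a^k b]; as [alpha = a^(N-k) C], cancelling [C] gives [C a^(N-k) ~ alpha], so
    [C C a^(N-k) ~ 1]. *)
Lemma full_rinv_block k : k <= n -> rinv (A ^+ k * B) -> full.
Proof.
case: k => [|k] hk; rewrite ?mul1g => Cr; apply: full_linv_a.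
  have alpha1 := rho_alpha_1 Cr; apply: (@linv_expg_a n.-1); rewrite prednK //.
  have AB1 : rho (A * B) 1.
    by rewrite -[X in rho _ X]rinv_alpha -{1}[_ * B]mul1g; apply/rhoMr/rho_sym.
  exists 1; rewrite mul1g; apply: rho_trans alpha1.
  by rewrite alphaE expgSr -mulgA -{1}[A ^+ n]mulg1; apply/rhoMl/rho_sym.
set C := A ^+ _ * B in Cr.
have aC : alpha * C = 1 by have := @alpha_block k.+1 1; rewrite mulg1 => ->.
have Ca : rho (C * alpha) 1.
  by apply: (cong_cancel_r Cr); rewrite -mulgA aC mulg1 mul1g.
have ea : alpha = A ^+ (n - k) * C.
  by rewrite /C mulgA -expgnDr alphaE; congr (A ^+ _ * B); lia.
have Ca' : rho (C * A ^+ (n - k)) alpha.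
  by apply: (cong_cancel_r Cr); rewrite aC -mulgA -ea.
apply: (@linv_expg_a (n - k).-1); rewrite prednK; last by lia.
by exists (C * C); rewrite -mulgA; apply: rho_trans Ca; apply: rhoMl.
Qed.

Lemma full_high_block k J m y : k <= n ->
  rho (eval (high_word J m)) (A ^+ k * (B * y)) -> full.
Proof.
move=> hk h; apply: (full_rinv_block hk); have [q rq] := rinv_high J m.
exists (y * q); rewrite -mulgA (mulgA B) mulgA -rq.
exact/rhoMr/rho_sym.
Qed.

Lemma beta_block_b K y : 0 < K <= n ->
  alpha * (A * (A ^+ K * (B * (B * y)))) = B * y.
Proof.
move=> hK; rewrite (mulgA A) -expgS; have [ltK|geK] := ltnP K n.
  by rewrite alpha_block.
(* No rule has [i = N], but here [a^N b] is itself [alpha], which fixes [b y]. *)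
have -> : K = n by lia.
by rewrite (mulgA (A ^+ N)) -alphaE !alpha_b.
Qed.

(* The two implications must be proved together: cancelling the first block of the
   word turns either relation into one of the two for a shorter word. *)
Lemma full_low L : all (fun k => k <= n) L ->
  (forall K, 0 < K <= n ->
     rho (A ^+ K * (B * eval (low_word L))) (alpha * eval (low_word L)) -> full)
  /\ (rho (B * eval (low_word L)) (eval (low_word L)) -> full).
Proof.
elim: L => [|k L IH].
  move=> _; rewrite [eval (low_word _)](_ : _ = 1) //; split=> [K hK|].
    rewrite !mulg1 => /(rhoMr (A * B)); rewrite rinv_alpha => h.
    by apply: (@full_rinv_block K); [lia|exists (A * B)].
  by move=> h; apply: (@full_rinv_block 0) => //; exists 1; rewrite mul1g.
case/andP=> hk /IH[S1 S2]; rewrite eval_block; move: (eval (low_word L)) S1 S2 => y S1 S2.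
case: k hk => [|k] hk.
  rewrite mul1g; split=> [K hK|] /(rhoMl (alpha * A)).
    by rewrite -!mulgA beta_block_b // alpha_b beta_b.
  by rewrite -!mulgA !beta_b.
split=> [K hK|].
  rewrite alpha_block // => /(rhoMl alpha); rewrite alpha_block //.
  exact: S1.
(* Put [x = a^(k+1) b y]. Multiplying [b x ~ x] by [alpha] gives [b x ~ y], so [x ~ y]. Multiplying
   again gives [y ~ alpha y], hence [x ~ alpha y], the first relation for [y]. *)
move=> h; have := rhoMl alpha h; rewrite alpha_b alpha_block // => h1.
have h2 := rho_trans (rho_sym h) h1; have := rhoMl alpha h2.
rewrite alpha_block // => h3; apply: (S1 _ _ (rho_trans h2 h3)) => //.
Qed.

Lemma full_block_alpha K x : 0 < K <= n ->
  rho (A ^+ K * (B * x)) (alpha * x) -> full.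
Proof.
move=> hK; have [[L J m] vs ->] := eval_state x; have [q rq] := rinv_high J m.
rewrite /state_word evalM => /(rhoMr q); rewrite -!mulgA rq mulg1.
by apply: (full_low vs).1.
Qed.

Lemma full_b_fix x : rho (B * x) x -> full.
Proof.
have [[L J m] vs ->] := eval_state x; have [q rq] := rinv_high J m.
rewrite /state_word evalM => /(rhoMr q); rewrite -!mulgA rq mulg1.
exact: (full_low vs).2.
Qed.

(** Multiplying by [alpha] strips the first blocks, except that [alpha] fixes [b x]. The last two
    hypotheses are the induction hypotheses for the resulting pairs; if such a pair is trivial, the
    relation reduces to [full_b_fix] or [full_block_alpha]. *)
Lemma full_blocks k k' x y : k < k' <= n ->
  rho (A ^+ k * (B * x)) (A ^+ k' * (B * y)) ->
  (x <> y -> rho x y -> full) -> (B * x <> y -> rho (B * x) y -> full) -> full.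
Proof.
case/andP=> ltk lek; case: k ltk => [|k] ltk h IH1 IH2.
  have h1 : rho (B * x) y.
    by have := rhoMl alpha h; rewrite mul1g alpha_b alpha_block ?ltk.
  have [e|/IH2] := EM (B * x = y); last exact.
  subst y; move/(rhoMl (alpha * A)): h.
  rewrite -!mulgA mul1g beta_b beta_block_b ?ltk // => /rho_sym.
  exact: full_b_fix.
have h1 : rho x y.
  by have := rhoMl alpha h; rewrite !alpha_block //; lia.
have [e|/IH1] := EM (x = y); last exact.
(* This power turns the longer block into [alpha] and keeps the exponent of the shorter one between
   [1] and [n]. *)
subst y; move/(rhoMl (A ^+ (N - k'))): h.
rewrite !mulgA -!expgnDr -[N - k' + k']/(_) subnK; last by lia.
rewrite -alphaE -mulgA; apply: full_block_alpha; lia.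
Qed.

(** * Induction on total length *)

Definition separated d := forall s t, valid s -> valid t -> s <> t ->
  size (state_word s) + size (state_word t) < d ->
  rho (eval (state_word s)) (eval (state_word t)) -> full.

Lemma eval_high_tail J m :
  eval (high_word J m.+1) = eval (high_word J m) * A.
Proof. by rewrite -addn1 high_word_tail evalM. Qed.

Lemma eval_high0 j J :
  eval (high_word (j :: J) 0) = eval (high_word J j) * alpha.
Proof. by rewrite eval_high mulg1. Qed.

Lemma size_high_word j J m : size (high_word (j :: J) m) = size (high_word J j) + N + m.+1.
Proof. by rewrite /= addnC high_word_tail !size_cat /= !size_nseq. Qed.

Lemma size_high_tail J m : size (high_word J m.+1) = (size (high_word J m)).+1.
Proof. by rewrite -addn1 high_word_tail size_cat addn1. Qed.

(* If multiplying by [a^n b] gives equal words, the pair is [(r a, r alpha alpha)].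
   Multiplying by [ab] then gives [(r a a b, r alpha)], distinct unless [n = 1],
   where [alpha = a a b]; in that case multiplying by [b] gives [(r a b, r b)]. *)
Lemma full_a_alpha J m J' :
  separated (size (high_word J m.+1) + size (high_word J' 0)) ->
  rho (eval (high_word J m.+1)) (eval (high_word J' 0)) -> full.
Proof.
rewrite eval_high_tail size_high_tail; case: J' => [|j J'] IH h.
  by apply: full_linv_a; exists (eval (high_word J m)).
rewrite eval_high0 in h; rewrite size_high_word in IH.
have h1 : rho (eval (high_word (m :: J) 0)) (eval (high_word J' j)).
  have := rhoMr (A ^+ n * B) h; rewrite -!mulgA alpha_anb (mulgA A) -expgS.
  by rewrite eval_high0 -alphaE mulg1.
have [[e1 e2]|ne] := EM (m :: J = J' /\ 0 = j); last first.
  apply: (IH (State [::] (m :: J) 0) (State [::] J' j)) h1 => //.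
    by case=> e1 e2; apply: ne.
  by rewrite /state_word /= -/(high_word (m :: J) 0) size_high_word; lia.
subst j J'; rewrite eval_high0 in h; rewrite size_high_word in IH.
have run3 w : eval (high_word J m) * eval w = eval (state_word (run (State [::] J m) w)).
  by rewrite -eval_run.
have [n1|n2] : n = 1%N \/ 1 < n by lia.
  have h2 : rho (eval (state_word (run (State [::] J m) [:: false; true])))
                (eval (state_word (run (State [::] J m) [:: true]))).
    rewrite -!run3 (evalM [:: false]) mulgA.
    have := rhoMr B h; rewrite -!mulgA.
    by have := alpha_b 1; rewrite !mulg1 => e; rewrite !e.
  apply: IH h2; [exact: valid_run|exact: valid_run|exact: push_b1_neq|].
  have := size_run (State [::] J m) [:: false; true].
  have := size_run (State [::] J m) [:: true].
  by rewrite /state_word /=; lia.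
have h2 : rho (eval (state_word (run (State [::] J m) [:: false; false; true])))
              (eval (high_word (m :: J) 0)).
  rewrite -run3 (evalM [:: false] [:: false; true]) (evalM [:: false] [:: true]) eval_high0.
  have := rhoMr (A * B) h; rewrite -!mulgA.
  by rewrite rinv_alpha mulg1.
apply: (IH _ (State [::] (m :: J) 0)) h2 => //; [exact: valid_run|exact: push_b2_neq|].
have := size_run (State [::] J m) [:: false; false; true].
by rewrite /state_word /= -/(high_word (m :: J) 0) size_high_word; lia.
Qed.

(** Since [alpha a^n b = 1], the relation [r alpha ~ 1] becomes [r ~ a^n b] with [r] right
    invertible. *)
Lemma full_high_1 j J : rho (eval (high_word (j :: J) 0)) 1 -> full.
Proof.
rewrite eval_high0 => /(rhoMr (A ^+ n * B)); rewrite -mulgA alpha_anb mulg1 mul1g => h.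
by apply: (@full_high_block n J j 1) => //; rewrite mulg1.
Qed.

(** If both [l] are empty, the last factors [a] or [alpha] are compared, and equal ones cancel on
    the right. If one is empty, a block [a^k b] becomes right invertible. Otherwise the first blocks
    are compared, and equal ones cancel on the left. *)
Lemma separated_all d : separated d.
Proof.
elim: d => // d IH [L J m] [L' J' m'] vs vt ne le h.
have IHd d' : d' <= d -> separated d'.
  by move=> led s t ? ? ? lt; apply: IH => //; apply: leq_trans lt led.
case: L L' vs vt ne le h => [|k L] [|k' L'] vs vt ne le h; rewrite /state_word /= in le h.
- case: m m' {vs vt} ne le h => [|m] [|m'] ne le h.
  + case: J J' ne le h => [|j J] [|j' J'] // ne le h.
    * exact: (full_high_1 (rho_sym h)).
    * exact: (full_high_1 h).
    * rewrite -/(high_word (_ :: _) _) in le; rewrite -/(high_word (_ :: _) _) in h.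
      rewrite !eval_high0 in h; rewrite !size_high_word in le.
      apply: (IH (State [::] J j) (State [::] J' j')) => //.
      - by case=> e1 e2; apply: ne; rewrite e1 e2.
      - by rewrite /state_word /=; lia.
      - by apply: cong_cancel_r h; exists (A * B); rewrite rinv_alpha.
  + by apply: full_a_alpha (rho_sym h); apply: IHd; lia.
  + by apply: full_a_alpha h; apply: IHd; lia.
  + rewrite !eval_high_tail in h; rewrite !size_high_tail in le.
    apply: (IH (State [::] J m) (State [::] J' m')) => //.
    * by case=> e1 e2; apply: ne; rewrite e1 e2.
    * by rewrite /state_word /=; lia.
    * by apply: cong_cancel_r h; apply/rinv_rho/rinv_a.
- case/andP: vt => hk' _; rewrite -catA /= eval_block in h.
  exact: (full_high_block hk' h).
- case/andP: vs => hk _; rewrite -catA /= eval_block in h.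
  exact: (full_high_block hk (rho_sym h)).
- case/andP: vs => hk vs; case/andP: vt => hk' vt.
  rewrite -!catA /= !eval_block in h; rewrite -!catA !size_cat /= !size_nseq in le.
  pose s := State L J m; pose t := State L' J' m'.
  have es : size (state_word s) = size (low_word L) + size (high_word J m).
    exact: size_cat.
  have et : size (state_word t) = size (low_word L') + size (high_word J' m').
    exact: size_cat.
  have IHst : eval (state_word s) <> eval (state_word t) ->
      rho (eval (state_word s)) (eval (state_word t)) -> full.
    move=> nst; apply: IH => //; first by move=> e; apply: nst; rewrite e.
    by rewrite es et; lia.
  (* Prepending [b] to a normal form adds the block [a^0 b] to [l]. The extra letter is paid for by
     the two removed blocks. *)
  have Bst (s' t' : state) : valid s' -> valid t' ->
      size (state_word s') + 1 + size (state_word t') < d ->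
      B * eval (state_word s') <> eval (state_word t') ->
      rho (B * eval (state_word s')) (eval (state_word t')) -> full.
    case: s' => L1 J1 m1 v1 v2 lt.
    rewrite -(evalM [:: true]) => nst.
    apply: (IH (State (0 :: L1) J1 m1)) => //; first by move=> e; apply: nst; rewrite -e.
    by move: lt; rewrite /state_word /= !size_cat; lia.
  have [lt|lt|e] := ltngtP k k'.
  + apply: (full_blocks _ h) => //; first by rewrite lt.
    by apply: (Bst s t) => //; rewrite es et; lia.
  + apply: (full_blocks _ (rho_sym h)) => //; first by rewrite lt.
      by move=> nst hst; apply: IHst; [apply: nesym|apply: rho_sym].
    by apply: (Bst t s) => //; rewrite es et; lia.
  + subst k'; have [p hp] := linv_block hk; have := rhoMl p h; rewrite !hp.
    by apply: IHst => /(@eval_inj s t vs vt)[eL eJ em]; apply: ne; rewrite eL eJ em.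
Qed.

End Congruence.

Lemma congruence_free_M : congruence_free Q.
Proof.
move=> rho rhoC u v uv h.
have [s vs eu] := eval_state u; have [t vt ev] := eval_state v.
apply: (separated_all rhoC vs vt _ (ltnSn _)); first by move=> e; apply: uv; rewrite eu ev e.
by rewrite -eu -ev.
Qed.

End Words.

Theorem mainTheorem1 (n : nat) (hn : 1 <= n) :
  [/\ noetherian (M_rules n),
      confluent (M_rules n),
      bisimple (M_monoid n),
      Htrivial (M_monoid n)
    & congruence_free (M_monoid n)].
Proof.
split; [exact: noetherian_rules|exact: confluent_rules|exact: bisimple_M
  |exact: Htrivial_M|exact: congruence_free_M].
Qed.
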